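(* Let $p\ge2$ be an integer and let $Y\subset\mathbb{T}$ be a nonempty compact subset invariant under $T_p$, and suppose $T_p\colon Y\to Y$ has positive topological entropy. Then for every $\varepsilon>0$, the set $$\{n\in\mathbb{N} : nY \text{ is } \varepsilon\text{-dense in }\mathbb{T}\}$$ is a multiplicatively syndetic subset of $\mathbb{N}$.
   Context: $\mathbb{N}=\{1,2,\dots\}$, $\mathbb{T}=\mathbb{R}/\mathbb{Z}$, $T_n\colon\mathbb{T}\to\mathbb{T}$ is $T_n(x)=nx\bmod 1$, and $nY=T_n(Y)$. A set $Y$ is invariant under $T_p$ if $T_p(Y)=Y$. A set $A\subset\mathbb{T}$ is $\varepsilon$-dense if every point of $\mathbb{T}$ is at distance less than $\varepsilon$ from $A$. A set $S\subset\mathbb{N}$ is multiplicatively syndetic if there is a finite set $F\subset\mathbb{N}$ such that for every $t\in\mathbb{N}$ there exists $f\in F$ with $ft\in S$. *)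

(* Defs.v *)
From HB Require Import structures.
From mathcomp Require Import all_boot all_order all_algebra finmap ring_quotient.
From mathcomp Require Import all_classical all_reals all_analysis.

Set Implicit Arguments.
Unset Strict Implicit.
Unset Printing Implicit Defensive.
Import Order.TTheory GRing.Theory Num.Theory.
Import numFieldNormedType.Exports.
Local Open Scope classical_set_scope.
Local Open Scope ring_scope.

(* The distance from a real number to the nearest integer. *)
Definition dist_int {R : realType} (a : R) : R :=
  Num.min (a - (Num.floor a)%:~R) (1 - (a - (Num.floor a)%:~R)).

Section DistInt.
Context {R : realType}.
Implicit Types (a b : R) (k : int).

Lemma dist_int_le a k : dist_int a <= `|a - k%:~R|.
Proof.
rewrite /dist_int ge_min; have [h|h] := leP k (Num.floor a).
  apply/orP; left; rewrite (le_trans _ (ler_norm _))// lerD2l lerN2.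
  by rewrite ler_int.
apply/orP; right; rewrite -normrN (le_trans _ (ler_norm _))// !opprB addrA.
by rewrite lerD2r addrC -[1]/(1%:~R) -intrD ler_int lezD1.
Qed.

Lemma dist_int_attained a : exists k, dist_int a = `|a - k%:~R|.
Proof.
have /andP[h1 h2] := floor_itv a.
rewrite /dist_int minEle; case: ifP => _.
  by exists (Num.floor a); rewrite ger0_norm// subr_ge0.
exists (Num.floor a + 1); rewrite distrC ger0_norm; last first.
  by rewrite subr_ge0 ltW.
by rewrite intrD opprB addrA [1 + _]addrC.
Qed.

Lemma dist_int0 : dist_int (0 : R) = 0.
Proof. by rewrite /dist_int floor0 subr0 subr0 minEle ler01. Qed.

Lemma dist_int_eq0 a : dist_int a = 0 -> a \is a Num.int.
Proof.
have [k ->] := dist_int_attained a.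
by move=> /eqP; rewrite normr_eq0 subr_eq0 => /eqP ->; exact: intr_int.
Qed.

Lemma dist_intN a : dist_int (- a) = dist_int a.
Proof.
suff h b : dist_int (- b) <= dist_int b.
  by apply/eqP; rewrite eq_le h -{1}[a]opprK h.
have [k ->] := dist_int_attained b.
by rewrite (le_trans (dist_int_le _ (- k)))// intrN -opprD normrN.
Qed.

Lemma dist_intD a b : dist_int (a + b) <= dist_int a + dist_int b.
Proof.
have [k ->] := dist_int_attained a; have [l ->] := dist_int_attained b.
rewrite (le_trans (dist_int_le _ (k + l)))//.
by rewrite intrD opprD addrACA ler_normD.
Qed.

Lemma dist_int_periodic a b : a - b \is a Num.int -> dist_int a = dist_int b.
Proof.
suff h (c d : R) : c - d \is a Num.int -> dist_int c <= dist_int d.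
  by move=> ab; apply/eqP; rewrite eq_le !h// -opprB rpredN.
move=> /intrP[m cd]; have [k ->] := dist_int_attained d.
rewrite (le_trans (dist_int_le _ (m + k)))// intrD -cd.
by rewrite opprD opprB !addrA [c + d]addrC addrK.
Qed.

End DistInt.

(* The subgroup Z of R: [Num.int_num_subdef] is the predicate underlying the
   qualifier [Num.int]. *)
Definition int_subgroup (R : realType) : zmodClosed R :=
  GRing.ZmodClosed.clone R (@Num.int_num_subdef R) _.

Definition circle (R : realType) : Type := Quotient.quot (int_subgroup R).

Section Circle.
Context {R : realType}.

HB.instance Definition _ :=
  ZmodQuotient.copy (circle R) (Quotient.quot (int_subgroup R)).

Definition circle_pi (a : R) : circle R := \pi_(circle R)%qT a.

Definition circle_dist (x y : circle R) : R := dist_int (repr x - repr y).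

Let circle_distxx x : circle_dist x x = 0.
Proof. by rewrite /circle_dist subrr dist_int0. Qed.

Let circle_dist_eq0 x y : circle_dist x y = 0 -> x = y.
Proof.
by move=> /dist_int_eq0; rewrite Quotient.idealrBE => /eqP; rewrite !reprK.
Qed.

Let circle_distC x y : circle_dist x y = circle_dist y x.
Proof. by rewrite /circle_dist -dist_intN opprB. Qed.

Let circle_distD y x z : circle_dist x z <= circle_dist x y + circle_dist y z.
Proof. by rewrite (le_trans _ (dist_intD _ _))// addrA subrK. Qed.

HB.instance Definition _ := @isMetric.Build R (circle R)
  circle_dist circle_distxx circle_dist_eq0 circle_distC circle_distD.

Lemma circle_pi_repr (x : circle R) : circle_pi (repr x) = x.
Proof. exact: reprK. Qed.

Lemma circle_pi_eq (a b : R) :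
  a - b \is a Num.int -> circle_pi a = circle_pi b.
Proof. by rewrite Quotient.idealrBE => /eqP. Qed.

Lemma mdist_circle_pi (a b : R) :
  mdist (circle_pi a) (circle_pi b) = dist_int (a - b).
Proof.
have pK c : repr (circle_pi c) - c \is a Num.int.
  by rewrite Quotient.idealrBE reprK.
rewrite /mdist/= /circle_dist; apply: dist_int_periodic.
by rewrite opprD addrACA -opprD rpredB.
Qed.

(* The metric induces the quotient topology of R/Z. *)
Lemma open_circleE (U : set (circle R)) :
  open U <-> open (circle_pi @^-1` U).
Proof.
rewrite !openE; split=> oU.
- move=> a /= /oU; rewrite /interior -!nbhs_ballE => -[e /= e0 eU].
  exists e => //= b ab; apply: eU; rewrite ballEmdist/= mdist_circle_pi.
  by rewrite (le_lt_trans (dist_int_le _ 0))// subr0.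
- move=> x; rewrite -[x]circle_pi_repr => /oU.
  rewrite /interior -!nbhs_ballE => -[e /= e0 eU].
  exists e => //= y; rewrite -[y]circle_pi_repr ballEmdist/= mdist_circle_pi.
  have [k ->] := dist_int_attained (repr x - repr y) => xyk.
  rewrite (@circle_pi_eq _ (repr y + k%:~R)); last first.
    by rewrite opprD addrA subrr sub0r rpredN intr_int.
  by apply: eU; rewrite /ball/= opprD addrA.
Qed.

(* [x *+ n] is the n-fold sum in R/Z, so [times n] is x |-> n x mod 1. *)
Definition times (n : nat) (x : circle R) : circle R := x *+ n.

Lemma times_circle_pi (n : nat) (a : R) :
  times n (circle_pi a) = circle_pi (n%:R * a).
Proof. by rewrite mulr_natl /times /circle_pi raddfMn. Qed.

End Circle.

(* Topological entropy, following Bowen and Dinaburg. *)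
Section Entropy.
Context {R : realType} {X : metricType R}.
Variables (f : X -> X).

Definition bowen_dist (n : nat) (x y : X) : R :=
  \big[Num.max/0]_(k < n) mdist (iter k f x) (iter k f y).

Definition separated (n : nat) (e : R) (E : set X) :=
  forall x y, E x -> E y -> x <> y -> e < bowen_dist n x y.

(* The largest cardinality of an (n, e)-separated subset of Y. *)
Definition sep_number (Y : set X) (n : nat) (e : R) : \bar R :=
  ereal_sup [set (#|` E|%:R)%:E | E in
    [set E : {fset X} | [set` E] `<=` Y /\ separated n e [set` E]]].

(* The growth rate is nonincreasing in e, so the supremum over e > 0 is its
   limit as e tends to 0. *)
Definition topological_entropy (Y : set X) : \bar R :=
  ereal_sup [set limn_esup (fun n => (n%:R^-1)%:E * lne (sep_number Y n e))%E
    | e in [set e : R | 0 < e]].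

End Entropy.

Definition eps_dense {R : realType} {X : metricType R} (e : R) (A : set X) :=
  forall x, exists2 a, A a & mdist x a < e.

Definition positive_nat : set nat := [set n | (0 < n)%N].

Definition multiplicatively_syndetic (S : set nat) :=
  S `<=` positive_nat /\
  exists F : set nat, [/\ finite_set F, F `<=` positive_nat &
    forall t, positive_nat t -> exists2 f, F f & S (f * t)%N].

(* Main.v *)
Require Import Defs.
From mathcomp Require Import all_boot all_order all_algebra finmap.
From mathcomp Require Import all_classical all_reals all_analysis lra.
Import Order.TTheory GRing.Theory Num.Theory.
Import numFieldNormedType.Exports.
Local Open Scope classical_set_scope.
Local Open Scope ring_scope.
Set Implicit Arguments.
Unset Strict Implicit.
Unset Printing Implicit Defensive.

(** The key fact is that for every infinite set Y with pY inside Y and every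
    e > 0 there is a bound N such that each tY, with t >= 1, has an e-dense
    dilate f(tY) with 1 <= f <= N ([infinite_dilates_dense]). Positive entropy
    forces Y to be infinite, since the separated subsets of a finite set have
    bounded cardinality ([finite_entropy_le0]); the finite set {1, ..., N} is
    then a witness of syndeticity.

    To find N, suppose that it does not exist: for every N some dilate
    W_N = t_N Y has no e-dense dilate f W_N with 1 <= f <= N. All the W_N are
    infinite, because multiplication by t has finite fibres. Let Z be the limit
    of the W_N along a free ultrafilter. By compactness W_N lies in any given
    neighbourhood of Z for almost all N, and Z is closed under multiplication
    by p.

    The set Z is infinite ([ultra_limit_infinite]). If it were finite, its
    points would be separated; the p-orbit of a point w of a W_N close enough
    to Z would then follow the p-orbit of a single point z of Z, and
    multiplication by p being expansive, w = z. So W_N would be contained in Z,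
    hence finite.

    An infinite subset of the circle has dense dilates (a theorem of Glasner).
    Here is the argument for Z ([simultaneous_targets]). Let x be an
    accumulation point of Z. Points s_1, s_2, ... of Z are chosen successively,
    each much closer to x than the previous ones, together with multipliers r_k
    such that r_k (s_k - x) is near the k-th point of a fine net, while
    r_k (s_j - x) is near 0 for j < k. Such an r_k exists because the r that
    bring the finitely many earlier differences near 0 have bounded gaps L,
    whereas the multiples of s_k - x advance by less than e/L at each step. With
    n the sum of the r_k, the set n(Z - x) is nearly dense, and so is nZ.

    As only finitely many points of Z are used, nW_N is e-dense for almost all
    N, in particular for some N >= n, which contradicts the choice of W_N. *)

(** * Distance to 0 on the circle, expansiveness, compactness *)

Section CircleNorm.
Context {R : realType}.
Implicit Types (x y z : circle R) (a : R) (n : nat).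

Lemma circle_pi_surj x : exists a, x = circle_pi a.
Proof. by exists (repr x); rewrite circle_pi_repr. Qed.

Definition cnorm x : R := mdist x 0.

Lemma circle_piD (a b : R) :
  circle_pi (a + b) = circle_pi a + circle_pi b.
Proof. by rewrite /circle_pi raddfD. Qed.

Lemma circle_piB (a b : R) :
  circle_pi (a - b) = circle_pi a - circle_pi b.
Proof. by rewrite /circle_pi raddfB. Qed.

Lemma circle_pi0 : circle_pi (0 : R) = 0.
Proof. by rewrite -(subrr (0 : R)) circle_piB subrr. Qed.

Lemma cnorm_pi a : cnorm (circle_pi a) = dist_int a.
Proof. by rewrite /cnorm -circle_pi0 mdist_circle_pi subr0. Qed.

Lemma mdist_cnorm x y : mdist x y = cnorm (x - y).
Proof.
have [a ->] := circle_pi_surj x; have [b ->] := circle_pi_surj y.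
by rewrite -circle_piB cnorm_pi mdist_circle_pi.
Qed.

Lemma cnorm_ge0 x : 0 <= cnorm x. Proof. exact: mdist_ge0. Qed.

Lemma cnorm0 : cnorm 0 = 0. Proof. exact: mdistxx. Qed.

Lemma cnorm_eq0 x : cnorm x = 0 -> x = 0.
Proof. exact: mdist_positivity. Qed.

Lemma cnormB x y : cnorm (x - y) = cnorm (y - x).
Proof. by rewrite -!mdist_cnorm metric_sym. Qed.

Lemma cnormD x y : cnorm (x + y) <= cnorm x + cnorm y.
Proof.
have [a ->] := circle_pi_surj x; have [b ->] := circle_pi_surj y.
by rewrite -circle_piD !cnorm_pi dist_intD.
Qed.

Lemma cnorm_trans y x z : cnorm (x - z) <= cnorm (x - y) + cnorm (y - z).
Proof. by rewrite -!mdist_cnorm metric_triangle. Qed.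

Lemma cnorm_times_le n x : cnorm (times n x) <= n%:R * cnorm x.
Proof.
elim: n => [|n IH]; first by rewrite /times mulr0n cnorm0 mul0r.
rewrite /times mulrSr -natr1 mulrDl mul1r (le_trans (cnormD _ _))//.
by rewrite lerD2r.
Qed.

(** The representative nearest to 0 turns estimates on the circle into estimates
    on real numbers. *)
Lemma cnorm_lift x : exists2 a, x = circle_pi a & `|a| = cnorm x.
Proof.
have [a xa] := circle_pi_surj x; have [k ak] := dist_int_attained a.
exists (a - k%:~R); last by rewrite xa cnorm_pi ak.
by rewrite xa; apply: circle_pi_eq; rewrite opprB addrC subrK intr_int.
Qed.

Lemma dist_int_small a : `|a| <= 2^-1 -> dist_int a = `|a|.
Proof.
move=> a2; apply/eqP; rewrite eq_le; apply/andP; split.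
  by rewrite (le_trans (dist_int_le _ 0))// subr0.
have [k ->] := dist_int_attained a.
have [->|k0] := eqVneq k 0; first by rewrite subr0.
have k1 : 1 <= `|k%:~R : R|.
  by rewrite -intr_norm -[1]/(1%:~R) ler_int -gtz0_ge1 normr_gt0.
have := ler_distD a (k%:~R : R) 0; rewrite !subr0 distrC => kD.
lra.
Qed.

(** Multiplication by [n] is an honest dilation as long as it does not wrap
    around the circle. *)
Lemma cnorm_times_small n x : n%:R * cnorm x <= 2^-1 ->
  cnorm (times n x) = n%:R * cnorm x.
Proof.
have [a -> <-] := cnorm_lift x; rewrite times_circle_pi cnorm_pi => h.
by rewrite dist_int_small normrM ger0_norm.
Qed.

Lemma times_iter p k x : iter k (times p) x = times (p ^ k) x.
Proof.
elim: k => [|k IH]; first by rewrite /times expn0 mulr1n.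
by rewrite iterS IH /times expnSr mulrnA.
Qed.

(** While the orbit stays within [e] of 0 no step wraps around, so the distance
    to 0 is multiplied by [p] each time and would be unbounded if it were not
    0. *)
Lemma expansive (p : nat) (e : R) x : (2 <= p)%N -> p%:R * e <= 2^-1 ->
  (forall k, cnorm (iter k (times p) x) <= e) -> x = 0.
Proof.
move=> p2 pe xe; apply: cnorm_eq0; apply/eqP; rewrite eq_le cnorm_ge0 andbT.
have grow k : cnorm (iter k (times p) x) = p%:R ^+ k * cnorm x.
  elim: k => [|k IH]; first by rewrite expr0 mul1r.
  rewrite iterS cnorm_times_small; first by rewrite IH exprS mulrA.
  by rewrite (le_trans _ pe)// ler_wpM2l.
rewrite leNgt; apply/negP => x0.
have xe0 : 0 < e by apply: lt_le_trans x0 _; exact: (xe 0%N).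
pose k := (Num.truncn (e / cnorm x)).+1.
have ek : e / cnorm x < k%:R by rewrite truncnS_gt.
have := xe k; rewrite grow leNgt => /negP; apply.
rewrite -ltr_pdivrMr// (lt_le_trans ek)// -natrX ler_nat.
by rewrite ltnW// ltn_expl.
Qed.

Lemma circle_compact : compact [set: circle R].
Proof.
have -> : [set: circle R] = circle_pi @` `[0 : R, 1]%classic.
  apply/seteqP; split=> // x _; have [a ->] := circle_pi_surj x.
  have /andP[fa af] := floor_itv a.
  exists (a - (Num.floor a)%:~R); last first.
    by apply: circle_pi_eq; rewrite addrAC subrr sub0r rpredN intr_int.
  rewrite /= in_itv/= subr_ge0 fa lerBlDl.
  by rewrite (le_trans (ltW af))// intrD.
apply: continuous_compact; last exact: segment_compact.
apply: continuous_subspaceT => a U; rewrite -!nbhs_ballE => -[e /= e0 eU].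
exists e => //= b ab; apply: eU; rewrite ballEmdist/= mdist_circle_pi.
by rewrite (le_lt_trans (dist_int_le _ 0))// subr0.
Qed.

Lemma circle_net (e : R) : 0 < e ->
  exists s : seq (circle R), forall x, exists2 y, y \in s & cnorm (x - y) < e.
Proof.
move=> e0; pose K := (Num.truncn e^-1).+1.
have K0 : (0 : R) < K%:R by rewrite ltr0n.
exists [seq circle_pi (i%:R / K%:R) | i <- iota 0 K] => x.
have [a ->] := circle_pi_surj x; have /andP[fa af] := floor_itv a.
pose b := a - (Num.floor a)%:~R; pose i := Num.truncn (b * K%:R).
have b0 : 0 <= b * K%:R by rewrite mulr_ge0// subr_ge0.
have b1 : b < 1 by rewrite ltrBlDl (lt_le_trans af)// intrD.
have iK : (i < K)%N.
  by rewrite truncn_lt_nat// gtr_pMl.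
exists (circle_pi (i%:R / K%:R)).
  by apply/mapP; exists i => //; rewrite mem_iota.
have /andP[ib bi] := truncn_itv b0.
rewrite -circle_piB cnorm_pi (le_lt_trans (dist_int_le _ (Num.floor a)))//.
rewrite addrAC -/b -[b](mulfK (lt0r_neq0 K0)) -mulrBl normrM normfV.
rewrite (gtr0_norm K0) ltr_pdivrMr// (@lt_trans _ _ 1)//.
  by rewrite ger0_norm ?subr_ge0// ltrBlDl -natr1 in bi *.
by rewrite mulrC -ltr_pdivrMr// div1r truncnS_gt.
Qed.

End CircleNorm.

(** * Dense dilates of a set with an accumulation point *)

(** Pigeonhole with a uniform delay: [L] bounds the first occurrences of all the
    colours that occur. *)
Lemma bounded_recurrence (T : finType) (f : nat -> T) :
  exists L, forall m, exists2 l, (l <= minn L m)%N & f l = f m.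
Proof.
have /choice[b bP] (t : T) : exists b, forall m, f m = t ->
    exists2 l, (l <= minn b m)%N & f l = t.
  have [ex|nex] := pselect (exists k, f k == t); last first.
    by exists 0%N => m fm; case: nex; exists m; apply/eqP.
  have [b fb bmin] := ex_minnP ex.
  by exists b => m /eqP fm; exists b; [rewrite leq_min leqnn bmin|exact/eqP].
exists (\max_t b t) => m; have [l lb fl] := bP _ m erefl.
exists l => //; move: lb; rewrite !leq_min => /andP[lb ->].
by rewrite (leq_trans lb)// leq_bigmax.
Qed.

Section Circle.
Context {R : realType}.
Implicit Types (x y z d t : circle R) (S : set (circle R)) (e : R).

(** The times [m - l] at which all the [us] return near 0 have gaps at most [L]:
    colour [m] by the cells containing the [m u]; two times of the same colour
    differ by a return time. *)
Lemma times_recurrent (us : seq (circle R)) e : 0 < e ->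
  exists L, forall m, exists2 l, (l <= minn L m)%N &
    forall u, u \in us -> cnorm (times (m - l) u) < e.
Proof.
move=> e0; have [net netP] := @circle_net R (e / 2) (divr_gt0 e0 (ltr0n _ 2)).
have /choice[g gP] x : exists y, y \in net /\ cnorm (x - y) < e / 2.
  by have [y ? ?] := netP x; exists y.
pose colour x : 'I_(size net).+1 := inord (index (g x) net).
have colourP x y : colour x = colour y -> cnorm (x - y) < e.
  move=> /(congr1 (@nat_of_ord _)).
  rewrite !inordK ?ltnS ?index_size// => /(congr1 (nth 0 net)).
  have [gx xg] := gP x; have [gy yg] := gP y.
  rewrite !nth_index// => gxy.
  rewrite (le_lt_trans (cnorm_trans (g x) _ _))// (splitr e) ltrD//.
  by rewrite gxy cnormB.
have [L LP] := bounded_recurrence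
  (fun m => [ffun i : 'I_(size us) => colour (times m us`_i)]).
exists L => m; have [l lLm /ffunP fl] := LP m.
exists l => // _ /(nthP 0)[i ius <-].
have := fl (Ordinal ius); rewrite !ffunE /= => /esym /colourP.
by rewrite /times mulrnBr//; move: lLm; rewrite leq_min => /andP[].
Qed.

Definition clusters_at S x :=
  forall e, 0 < e -> exists2 s, S s & 0 < cnorm (s - x) < e.

(** The point is a cluster point of the filter of the sets that contain all but
    finitely many points of [S]. *)
Lemma infinite_clusters_at S : infinite_set S -> exists x, clusters_at S x.
Proof.
move=> Sinf; pose F : set_system (circle R) := [set A | finite_set (S `\` A)].
have FF : ProperFilter F.
  split; first by rewrite /F/= setD0.
  split; first by rewrite /F/= setDT.
    by move=> A B; rewrite /F/= setDIr finite_setU.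
  by move=> A B AB; apply: sub_finite_set; exact: setDS.
have [x [_ clx]] := circle_compact FF filterT.
exists x => e e0; have [||s [[Ss sx]]] := clx (S `\ x) (ball x e).
- apply: sub_finite_set (finite_set1 x) => s [Ss].
  by rewrite /= not_andE => -[]// /contrapT.
- exact: nbhsx_ballx.
rewrite ballEmdist/= metric_sym mdist_cnorm => se; exists s => //.
by rewrite se andbT -mdist_cnorm mdist_gt0; apply/eqP.
Qed.

(** The multiples of [d] wind around the circle in steps of length [cnorm d]:
    wait for a passage at [t] after time [L], then step back at most [L]
    times. *)
Lemma multiples_hit_target d t (L : nat) : 0 < cnorm d ->
  exists2 m, (L <= m)%N & forall l, (l <= L)%N ->
    cnorm (times (m - l) d - t) <= L.+1%:R * cnorm d.
Proof.
have [a -> <-] := cnorm_lift d; have [b ->] := circle_pi_surj t.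
rewrite normr_gt0 => a0.
(* The lift [b + k] of the target lies at least [L] steps away, on the side
   towards which the multiples of [a] move. *)
have [k Lk] : exists k : int, L%:R <= (b + k%:~R) / a.
  move: a0; rewrite neq_lt => /orP[a0|a0].
    exists (Num.floor (L%:R * a - b)); rewrite ler_ndivlMr//.
    by rewrite addrC -lerBrDr floor_le.
  exists (Num.ceil (L%:R * a - b)); rewrite ler_pdivlMr//.
  by rewrite addrC -lerBlDr ceil_ge.
pose q := (b + k%:~R) / a.
have q0 : 0 <= q by apply: le_trans Lk.
have /andP[mq qm] := truncn_itv q0; set m := Num.truncn q in mq qm.
have Lm : (L <= m)%N by rewrite truncn_ge_nat.
exists m => // l lL.
have lm := leq_trans lL Lm.
rewrite times_circle_pi -circle_piB cnorm_pi.
rewrite (le_trans (dist_int_le _ k))// -addrA -opprD.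
have -> : b + k%:~R = q * a by rewrite divfK.
rewrite -mulrBl normrM ler_wpM2r// natrB// ler_norml.
have lL' : (l%:R : R) <= L%:R by rewrite ler_nat.
have l0 : (0 : R) <= l%:R by [].
rewrite -!natr1 in qm *; apply/andP; split; lra.
Qed.

(** By induction on the list of targets, the tolerance being halved each time:
    [n] serves the old targets, and adding a return time [m - l] of the old
    differences, chosen to bring a new and much smaller difference to the new
    target, spoils them little. *)
Lemma simultaneous_targets S x (ts : seq (circle R)) e :
  clusters_at S x -> 0 < e ->
  exists2 n, (0 < n)%N & forall t, t \in ts ->
    exists2 s, S s & cnorm (times n (s - x) - t) < e.
Proof.
move=> Sx; elim: ts e => [|t0 ts IH] e e0; first by exists 1%N.
have e20 : 0 < e / 2 by rewrite divr_gt0.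
have [n n0 nP] := IH _ e20.
have /choice[s sP] t : exists s, t \in ts ->
    S s /\ cnorm (times n (s - x) - t) < e / 2.
  have [/nP[s Ss sn]|_] := boolP (t \in ts); first by exists s.
  by exists 0.
have [L LP] := times_recurrent [seq s t - x | t <- ts] e20.
(* At the new point [n] contributes an error [n * cnorm (s0 - x)] and the step
   to the target an error [L.+1 * cnorm (s0 - x)]. *)
have c0 : 0 < (n + L.+1)%:R :> R by rewrite ltr0n addnS.
have [s0 Ss0 /andP[s0x s0e]] := Sx _ (divr_gt0 e0 c0).
have [m Lm mP] := multiples_hit_target t0 L s0x.
have [l + lP] := LP m; rewrite leq_min => /andP[lL lm].
exists (n + (m - l))%N; first by rewrite addn_gt0 n0.
move=> t; rewrite inE => /predU1P[->|tts].
  exists s0 => //; rewrite /times mulrnDr -addrA (le_lt_trans (cnormD _ _))//.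
  rewrite ltr_pdivlMr// mulrC natrD mulrDl in s0e.
  by rewrite (le_lt_trans _ s0e)// lerD ?mP// cnorm_times_le.
have [Sst st] := sP t tts; exists (s t) => //.
rewrite /times mulrnDr addrAC (le_lt_trans (cnormD _ _))// (splitr e).
by rewrite ltrD//; apply: lP; exact: (map_f (fun t => s t - x)).
Qed.

End Circle.

(** * Limits of invariant sets along an ultrafilter *)

Lemma finite_separated {R : realType} (T : metricType R) (A : set T) :
  finite_set A ->
  exists2 d : R, 0 < d & forall x y, A x -> A y -> mdist x y < d -> x = y.
Proof.
move=> /finite_seqP[s ->].
exists (\big[Num.min/1]_(x <- s) \big[Num.min/1]_(y <- s | x != y) mdist x y).
  apply: lt_bigmin => // x _; apply: lt_bigmin => // y.
  by rewrite mdist_gt0.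
move=> x y /= xs ys; apply: contraTeq => xy; rewrite -leNgt.
apply: le_trans (ge_bigmin_seq _ x _ _ xs isT) _.
exact: ge_bigmin_seq.
Qed.

Section UltraLimit.
Context {R : realType} {I : Type} (U : set_system I) {UU : UltraFilter U}.
Implicit Types (W : I -> set (circle R)) (z : circle R) (e : R).

Definition ultra_limit W : set (circle R) :=
  [set z | forall e, 0 < e -> U [set i | exists2 w, W i w & cnorm (w - z) < e]].

(** Otherwise almost all [W i] contain a point [g i] far from the limit, and a
    cluster point of [g] belongs to the limit. *)
Lemma ultra_limit_near W e : 0 < e ->
  U [set i | forall w, W i w -> exists2 z, ultra_limit W z & cnorm (w - z) < e].
Proof.
move=> e0; set A := (X in U X); have [//|UA] := in_ultra_setVsetC A UU.
have /choice[g gP] i : exists w, ~ A i ->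
    W i w /\ forall z, ultra_limit W z -> e <= cnorm (w - z).
  have [Ai|nAi] := pselect (A i); first by exists 0.
  have /existsNP[w /not_implyP[Ww wz]] := nAi; exists w => _; split=> // z Zz.
  by rewrite leNgt; apply/negP => wze; apply: wz; exists z.
have [x [_ clx]] := @circle_compact R (g @ U) _ filterT.
have gx e' : 0 < e' -> U [set i | cnorm (g i - x) < e'].
  move=> e'0; set B := (X in U X); have [//|UB] := in_ultra_setVsetC B UU.
  have [||_ [[i nBi <-]]] := clx (g @` ~` B) (ball x e').
  - have : U (g @^-1` (g @` ~` B)); last by [].
    by apply: filterS UB => i nBi; exists i.
  - exact: nbhsx_ballx.
  by rewrite ballEmdist/= metric_sym mdist_cnorm.
have Zx : ultra_limit W x.
  move=> e' e'0; apply: filterS (filterI UA (gx _ e'0)) => i [/gP[Wg _] gxe].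
  by exists (g i).
have [i [/gP[_ /(_ _ Zx) egx]]] := filter_ex (filterI UA (gx _ e0)).
by rewrite /= ltNge egx.
Qed.

Lemma ultra_limit_invariant W (p : nat) : (0 < p)%N ->
  (forall i w, W i w -> W i (times p w)) ->
  forall z, ultra_limit W z -> ultra_limit W (times p z).
Proof.
move=> p0 Wp z Zz e e0; have p0' : 0 < p%:R :> R by rewrite ltr0n.
apply: filterS (Zz _ (divr_gt0 e0 p0')) => i [w Ww wz].
exists (times p w); first exact: Wp.
rewrite /times -mulrnBl (le_lt_trans (cnorm_times_le _ _))//.
by rewrite mulrC -ltr_pdivlMr.
Qed.

(** If the limit were finite, then by expansiveness some [W i] would be
    contained in it. *)
Lemma ultra_limit_infinite W (p : nat) : (2 <= p)%N ->
  (forall i w, W i w -> W i (times p w)) ->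
  (forall i, infinite_set (W i)) -> infinite_set (ultra_limit W).
Proof.
move=> p2 Wp Winf Zfin; set Z := ultra_limit W in Zfin.
have Zp := ultra_limit_invariant (ltnW p2) Wp.
have [d d0 dP] := finite_separated Zfin.
have c0 : 0 < p.+1%:R :> R by rewrite ltr0n.
pose e := Num.min 2^-1 d / p.+1%:R.
have e0 : 0 < e by rewrite divr_gt0// lt_min d0 invr_gt0 ltr0n.
have [pe2 ped] : p%:R * e + e <= 2^-1 /\ p%:R * e + e <= d.
  have -> : p%:R * e + e = Num.min 2^-1 d.
    by rewrite -[X in _ + X]mul1r -mulrDl natr1 mulrC divfK// lt0r_neq0.
  by rewrite !ge_min !lexx orbT.
have [i Wi] := filter_ex (ultra_limit_near W e0).
apply: (Winf i); apply: sub_finite_set Zfin => w Ww.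
have [z Zz wz] := Wi _ Ww; suff -> : w = z by [].
(* The point of [Z] near the next iterate of [w] is within [p * e + e <= d] of
   the next iterate of [z], hence equal to it. *)
have shadow k : [/\ W i (iter k (times p) w), Z (iter k (times p) z) &
    cnorm (iter k (times p) w - iter k (times p) z) < e].
  elim: k => [//|k [Wk Zk ke]].
  have Wk1 := Wp _ _ Wk; have Zk1 := Zp _ Zk.
  have [z' Zz' wz'] := Wi _ Wk1.
  suff zz' : z' = iter k.+1 (times p) z by split => //; rewrite -zz'.
  apply: dP => //; rewrite mdist_cnorm (lt_le_trans _ ped)//.
  rewrite (le_lt_trans (cnorm_trans (times p (iter k (times p) w)) _ _))//.
  rewrite addrC ler_ltD//; last by rewrite cnormB.
  rewrite /= /times -mulrnBl (le_trans (cnorm_times_le _ _))//.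
  by rewrite ler_wpM2l// ltW.
apply/eqP; rewrite -subr_eq0; apply/eqP.
apply: (@expansive _ p e) => // [|k].
  by rewrite (le_trans _ pe2)// lerDl ltW.
have [_ _ /ltW] := shadow k.
by rewrite !times_iter /times -mulrnBl.
Qed.

End UltraLimit.

(** * Entropy of finite sets *)

Lemma limn_esup_le_near {R : realType} (u : (\bar R)^nat) (l : \bar R) :
  (\forall n \near \oo, (u n <= l)%E) -> (limn_esup u <= l)%E.
Proof.
move=> [N _ uN]; apply: (@le_trans _ _ (ereal_sup (u @` [set n | N <= n]%N))).
  by apply: ereal_inf_lbound; exists [set n | N <= n]%N => //; exists N.
by apply: ge_ereal_sup => _ [n Nn <-]; exact: uN.
Qed.

Lemma finite_entropy_le0 {R : realType} (X : metricType R) (f : X -> X)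
  (Y : set X) : finite_set Y -> (topological_entropy f Y <= 0)%E.
Proof.
move=> Yfin; apply: ge_ereal_sup => _ [e /= e0 <-].
pose C : R := #|` fset_set Y|.+1%:R.
have C1 : 1 <= C by rewrite ler1n.
have sepC n : (lne (sep_number f Y n e) <= (ln C)%:E)%E.
  rewrite -lne_EFin ?(lt_le_trans ltr01)// lee_lne.
  - apply: ge_ereal_sup => _ [E [EY _] <-].
    rewrite lee_fin ler_nat ltnW// ltnS fsubset_leq_card//.
    rewrite -(set_fsetK E) -fset_set_sub//.
  - rewrite in_itv/= leey andbT; apply: le_ereal_sup_tmp; eexists.
      by exists fset0; [|reflexivity]; split=> [x|x y]; rewrite ?set_fset0.
    by rewrite lee_fin.
  - by rewrite in_itv/= leey andbT lee_fin (le_trans ler01).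
apply/lee_addgt0Pr => d d0; rewrite add0e; apply: limn_esup_le_near.
(* From here on [ln C <= n * d]. *)
exists (Num.truncn (ln C / d)).+1 => // n /= Nn.
have n0 : (0 : R) < n%:R by rewrite ltr0n (leq_trans _ Nn).
apply: (@le_trans _ _ (n%:R^-1%:E * (ln C)%:E)%E).
  by rewrite lee_wpmul2l// lee_fin invr_ge0 ltW.
rewrite -EFinM lee_fin ler_pdivrMl// -ler_pdivrMr//.
by rewrite (le_trans (ltW (truncnS_gt _)))// ler_nat.
Qed.

(** * Dilates of an infinite invariant set *)

Section Dilates.
Context {R : realType}.
Implicit Types (x y z : circle R) (Y : set (circle R)) (e : R).

(** The fibres are finite: an infinite one would contain two distinct points at
    distance at most [1 / (2 n)], and multiplication by [n] separates these. *)
Lemma times_infinite Y n : (0 < n)%N ->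
  infinite_set Y -> infinite_set (times n @` Y).
Proof.
move=> n0 Yinf nYfin; apply: Yinf.
have n0' : (0 : R) < n%:R by rewrite ltr0n.
apply: sub_finite_set (bigcup_finite (F := fun z => Y `&` times n @^-1` [set z])
  nYfin _) => [y Yy|z _].
  by exists (times n y) => //; exists y.
apply: contrapT => /infinite_clusters_at[x xP].
have c0 : 0 < (4 * n%:R)^-1 :> R by rewrite invr_gt0 mulr_gt0.
have [s [_ /= sz] /andP[s0 sx]] := xP _ c0.
have [s' [_ /= s'z] /andP[_ s'x]] := xP _ s0.
have : cnorm (times n (s - s')) = n%:R * cnorm (s - s').
  apply: cnorm_times_small; rewrite -ler_pdivlMl//.
  rewrite (le_trans (cnorm_trans x _ _))// [cnorm (x - _)]cnormB.
  have -> : n%:R^-1 * 2^-1 = (4 * n%:R)^-1 + (4 * n%:R)^-1 :> R.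
    rewrite invfM; lra.
  by rewrite lerD// ltW// (lt_trans s'x).
rewrite /times mulrnBl -!/(times _ _) sz s'z subrr cnorm0 => /esym/eqP.
rewrite mulf_eq0 gt_eqF//= => /eqP/cnorm_eq0/eqP; rewrite subr_eq0 => /eqP ss'.
by rewrite ss' ltxx in s'x.
Qed.

(** The bound on [f] is uniform in [t] although the dilates [t Y] can differ
    widely: were there a bad [t N] for each [N], the limit of the corresponding
    dilates would again be infinite, and one dilation factor that works for the
    limit would work for almost all of them. *)
Lemma infinite_dilates_dense Y (p : nat) e : (2 <= p)%N ->
  times p @` Y `<=` Y -> infinite_set Y -> 0 < e ->
  exists N, forall t, (0 < t)%N ->
    exists2 f, (0 < f <= N)%N & eps_dense e (times (f * t) @` Y).
Proof.
move=> p2 Yp Yinf e0; apply: contrapT => /forallNP bad.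
have /choice[t tP] N : exists t, (0 < t)%N /\ forall f, (0 < f <= N)%N ->
    ~ eps_dense e (times (f * t) @` Y).
  have /existsNP[t /not_implyP[t0 tN]] := bad N; exists t; split=> // f fN fd.
  by apply: tN; exists f.
pose W N := times (t N) @` Y.
have [U [UU Ucofin]] := @ultraFilterLemma _ (\oo : set_system nat) _.
have Wp N w : W N w -> W N (times p w).
  move=> [y Yy <-]; exists (times p y); first by apply: Yp; exists y.
  by rewrite /times -!mulrnA mulnC.
have Winf N : infinite_set (W N) by apply: times_infinite; have [] := tP N.
have [x Zx] := infinite_clusters_at (ultra_limit_infinite p2 Wp Winf (U := U)).
have [net netP] := @circle_net R (e / 2) (divr_gt0 e0 (ltr0n _ 2)).
have e40 : 0 < e / 4 by rewrite divr_gt0.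
have [n n0 nP] := simultaneous_targets net Zx e40.
have n0' : (0 : R) < n%:R by rewrite ltr0n.
have UW : U (\bigcap_(c in [set` [fset c in net]%fset])
    [set N | exists2 w, W N w & cnorm (times n (w - x) - c) < e / 2]).
  apply: filter_bigI => c; rewrite inE => /nP[s Zs sc].
  apply: filterS (Zs _ (divr_gt0 e40 n0')) => N [w Ww ws]; exists w => //.
  have -> : times n (w - x) - c = times n (w - s) + (times n (s - x) - c).
    by rewrite addrA /times -mulrnDl addrA subrK.
  have -> : e / 2 = e / 4 + e / 4 by lra.
  rewrite (le_lt_trans (cnormD _ _))// ltrD//.
  rewrite (le_lt_trans (cnorm_times_le _ _))//.
  by rewrite mulrC -ltr_pdivlMr.
have UN : U [set N | n <= N]%N by apply: Ucofin; exists n.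
have [N [/= nN NW]] := filter_ex (filterI UN UW).
have [_ tNn] := tP N; apply: (tNn n); first by rewrite n0.
move=> y; have [c cnet yc] := netP (y - times n x).
have [|_ [y0 Yy0 <-] wc] := NW c; first by rewrite /= inE.
exists (times (n * t N) y0); first by exists y0.
have -> : times (n * t N) y0 = times n (times (t N) y0).
  by rewrite /times mulnC mulrnA.
set w := times (t N) y0 in wc *.
rewrite mdist_cnorm.
have -> : y - times n w = (y - times n x - c) + (c - times n (w - x)).
  by rewrite addrA subrK /times mulrnBl opprB addrA subrK.
by rewrite (le_lt_trans (cnormD _ _))// (splitr e) ltrD// cnormB.
Qed.

End Dilates.

(** * Conclusion *)

Theorem corollary1p4 (R : realType) (p : nat) (Y : set (circle R)) :
  (2 <= p)%N ->
  Y !=set0 ->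
  compact Y ->
  times p @` Y = Y ->
  (0 < topological_entropy (times p) Y)%E ->
  forall eps : R, 0 < eps ->
  multiplicatively_syndetic
    [set n | positive_nat n /\ eps_dense eps (times n @` Y)].
Proof.
move=> p2 _ _ Yp Yent eps eps0; split; first by move=> n [].
have Yinf : infinite_set Y.
  by move=> /(finite_entropy_le0 (times p)); rewrite leNgt Yent.
have YpY : times p @` Y `<=` Y by rewrite Yp.
have [N NP] := infinite_dilates_dense p2 YpY Yinf eps0.
exists [set f | 0 < f <= N]%N; split.
- apply: sub_finite_set (finite_II N.+1) => f /andP[_ fN] /=.
  by rewrite ltnS.
- by move=> f /andP[].
- move=> t t0; have [f fN fd] := NP t t0; exists f => //; split=> //.
  by rewrite /positive_nat/= muln_gt0 t0 andbT; case/andP: fN.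
Qed.
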